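(* Let $N,q,d'\ge1$ be integers with $q\le\frac N2$ and let $d=d'+q+1$. Let $f:\mathbb{R}^{Nd}\to\mathbb{R}^{Nd'}$ be a fully-connected neural network of the form $f(x)=g(Wx)$, where $W\in\mathbb{R}^{m\times Nd}$ is a weight matrix and $g:\mathbb{R}^m\to\mathbb{R}^{Nd'}$ is an arbitrary function. If $f$ $\frac1{2q}$-approximates the $q$-sparse averaging function $q\mathrm{SA}$, then $m\ge\mathrm{rank}(W)\ge\frac{Nd'}2$.
   Context: Let $\mathbb{B}^{d'}$ be the Euclidean unit ball in $\mathbb{R}^{d'}$. Inputs to $q\mathrm{SA}$ are $X=(x_1,\dots,x_N)\in\mathbb{R}^{N\times d}$, $d=d'+q+1$, with $x_i=(z_i;y_i;i)$, $z_i\in\mathbb{B}^{d'}$, $y_i\in\binom{[N]}{q}$ (a $q$-element subset of $[N]=\{1,\dots,N\}$ encoded as a vector in $[N]^q$ with distinct components). Define $q\mathrm{SA}(X)=\left(\frac1q\sum_{j=1}^q z_{y_{i,j}}\right)_{i\in[N]}\in\mathbb{R}^{N\times d'}$. A function $f$ $\epsilon$-approximates $q\mathrm{SA}$ if for all such $X$, $\max_{i\in[N]}\|f(X)_i-q\mathrm{SA}(X)_i\|_2\le\epsilon$. Here inputs and outputs are regarded as flattened vectors in $\mathbb{R}^{Nd}$ and $\mathbb{R}^{Nd'}$ rather than as matrices, and $f(X)_i\in\mathbb{R}^{d'}$ denotes the $i$-th block of the output. *)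

(* Defs.v *)
From mathcomp Require Import all_boot all_order all_algebra.
From mathcomp Require Import reals.

Set Implicit Arguments.
Unset Strict Implicit.
Unset Printing Implicit Defensive.

Import Order.TTheory GRing.Theory Num.Theory.

Local Open Scope ring_scope.

(* MathComp-Analysis equips matrices with the sup norm, hence this definition. *)
Definition norm2 (R : realType) (n : nat) (v : 'rV[R]_n) : R :=
  Num.sqrt (\sum_(j < n) v 0 j ^+ 2).

(* An input is given by the matrix Z whose rows are the z_i and by the vectors
   y_i = (y i 0, ..., y i (q-1)). *)
Definition valid_qSA_input (R : realType) (N q d' : nat)
    (Z : 'M[R]_(N, d')) (y : 'I_N -> 'I_q -> 'I_N) : Prop :=
  (forall i, norm2 (row i Z) <= 1) /\ (forall i, injective (y i)).

(* Row i is (z_i; y_i; i).  Ordinals start at 0 whereas [N] = {1, ..., N}, so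
   both the components of y_i and the position i are shifted by one. *)
Definition qSA_input (R : realType) (N q d' : nat)
    (Z : 'M[R]_(N, d')) (y : 'I_N -> 'I_q -> 'I_N) : 'M[R]_(N, d' + q + 1) :=
  row_mx (row_mx Z (\matrix_(i < N, j < q) (y i j).+1%:R))
         (\col_(i < N) i.+1%:R).

(* qSA(X) for X = qSA_input Z y; this X determines Z and y. *)
Definition qSA (R : realType) (N q d' : nat)
    (Z : 'M[R]_(N, d')) (y : 'I_N -> 'I_q -> 'I_N) : 'M[R]_(N, d') :=
  \matrix_(i < N) (q%:R^-1 *: \sum_(j < q) row (y i j) Z).

(* Row-major flattening, concatenating the rows of a matrix. *)
Definition flatten_mx (R : realType) (N d : nat) (X : 'M[R]_(N, d)) :
    'cV[R]_(N * d) :=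
  (mxvec X)^T.

Definition block (R : realType) (N d : nat) (u : 'cV[R]_(N * d)) (i : 'I_N) :
    'rV[R]_d :=
  row i (vec_mx u^T).

Definition approximates_qSA (R : realType) (N q d' : nat) (eps : R)
    (f : 'cV[R]_(N * (d' + q + 1)) -> 'cV[R]_(N * d')) : Prop :=
  forall (Z : 'M[R]_(N, d')) (y : 'I_N -> 'I_q -> 'I_N),
    valid_qSA_input Z y ->
    \big[Num.max/0]_(i < N)
      norm2 (block (f (flatten_mx (qSA_input Z y))) i - row i (qSA Z y)) <= eps.

(* Main.v *)
(** If rank W < N d', some nonzero Z, normalised so that its longest row z_i is
    a unit vector, is invisible to W when added to the z-part of the input.  For
    every choice of y the inputs Z and -Z then get the same output, so with
    a_k = <z_k, z_i> every sum of a over q distinct indices has absolute value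
    at most 1/2.  Exchanging i for any other k in such a sum (possible since
    q < N) gives a_k >= a_i - 1 = 0, whence a sum of q terms including a_i is at
    least 1, a contradiction.  This gives rank W >= N d', without the factor
    1/2. *)
Require Import Defs.
From mathcomp Require Import all_boot all_order all_algebra all_fingroup.
From mathcomp Require Import reals ring lra.

Import Order.TTheory GRing.Theory Num.Theory.

Local Open Scope ring_scope.

(** Two sums in [[-c, c]] differ by at most [2 * c]. So if [a i >= 2 * c], exchanging [i] for [k]
    forces [a k >= 0] for every [k], and a sum containing [a i] exceeds [c]. *)
Lemma lt_of_injective_sums (R : realFieldType) (N q : nat) (a : 'I_N -> R)
    (c : R) (hq : (0 < q)%N) (hqN : (q < N)%N) (hc : 0 < c)
    (ha : forall y : 'I_q -> 'I_N, injective y -> `|\sum_(j < q) a (y j)| <= c)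
    (i : 'I_N) :
  a i < 2 * c.
Proof.
case: q hq hqN ha => // q _ hqN ha.
rewrite ltNge; apply/negP => hai.
(* After the case split the sums have [q.+1] terms. Injections are taken as permutations restricted
   to the first [q.+1] indices: [z0] is the first of these, [zq] the first index beyond them. *)
pose z0 : 'I_N := Ordinal (ltn_trans (ltn0Sn q) hqN).
pose zq : 'I_N := Ordinal hqN.
pose wd := widen_ord (ltnW hqN).
have wd_inj : injective wd by move=> x y /(congr1 val) /= /val_inj.
have wd0 : wd ord0 = z0 by apply: val_inj.
have bnd (s : {perm 'I_N}) : `|\sum_(j < q.+1) a (s (wd j))| <= c.
  by apply: ha => x y /perm_inj /wd_inj.
have a_ge0 k : 0 <= a k.
  have [-> | nki] := eqVneq k i; first by lra.
  pose k' := tperm z0 i k.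
  have nk0 : k' != z0 by rewrite -(inj_eq (@perm_inj _ (tperm z0 i))) tpermK tpermL.
  (* Products of permutations act from left to right. Putting [tperm z0 zq] in front of [s] replaces
     [i] by [k] at position [z0] and keeps the other summands, so the two sums differ by
     [a i - a k]. *)
  pose s := (tperm zq k' * tperm z0 i)%g.
  have s0 : s z0 = i by rewrite permM (tpermD _ nk0) ?tpermL.
  have sq : s zq = k by rewrite permM tpermL tpermK.
  have := bnd s; have := bnd (tperm z0 zq * s)%g.
  rewrite !big_ord_recl /= wd0 permM tpermL sq s0.
  under eq_bigr => j _ do rewrite permM tpermD -?val_eqE //= ?gtn_eqF ?ltnS //.
  by rewrite !ler_norml => /andP[? ?] /andP[? ?]; lra.
have := bnd (tperm z0 i).
rewrite big_ord_recl /= wd0 tpermL ler_norml => /andP[_].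
have : 0 <= \sum_(j < q) a (tperm z0 i (wd (lift ord0 j))) by apply: sumr_ge0.
by lra.
Qed.

Lemma norm2_sqr (R : realType) (n : nat) (v : 'rV[R]_n) :
  norm2 v ^+ 2 = \sum_(j < n) v 0 j ^+ 2.
Proof. by rewrite sqr_sqrtr //; apply: sumr_ge0 => j _; rewrite sqr_ge0. Qed.

Lemma norm2Z (R : realType) (n : nat) (c : R) (v : 'rV[R]_n) :
  norm2 (c *: v) = `|c| * norm2 v.
Proof.
rewrite /norm2 -sqrtr_sqr -sqrtrM ?sqr_ge0 // mulr_sumr.
by congr Num.sqrt; apply: eq_bigr => j _; rewrite mxE exprMn.
Qed.

Lemma norm2_eq0 (R : realType) (n : nat) (v : 'rV[R]_n) :
  (norm2 v == 0) = (v == 0).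
Proof.
rewrite -sqrf_eq0 norm2_sqr psumr_eq0 => [|j _]; last exact: sqr_ge0.
apply/allP/eqP => [v0 | -> j _]; last by rewrite mxE expr0n /= eqxx.
apply/rowP => j; rewrite mxE; apply/eqP.
by rewrite -sqrf_eq0 (implyP (v0 j (mem_index_enum j))).
Qed.

(** Expanding [(v_j - t * w_j)^2 >= 0] bounds each [t * v_j * w_j] by [(v_j^2 + t^2 * w_j^2) / 2];
    these sum to at most [t^2], and [t > 0] can be cancelled. *)
Lemma dot_le_norm2 (R : realType) (n : nat) (v w : 'rV[R]_n) (t : R) :
  0 < t -> norm2 v <= t -> norm2 w = 1 -> \sum_(j < n) v 0 j * w 0 j <= t.
Proof.
move=> t0 vt w1.
have v0 : 0 <= norm2 v by exact: sqrtr_ge0.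
have vt2 : norm2 v ^+ 2 <= t ^+ 2 by rewrite ler_sqr ?nnegrE // ltW.
rewrite -(ler_pM2l t0) mulr_sumr.
apply: (@le_trans _ _ ((norm2 v ^+ 2 + t ^+ 2 * norm2 w ^+ 2) / 2)); last first.
  by rewrite w1; lra.
rewrite !norm2_sqr mulr_sumr -big_split /= mulr_suml; apply: ler_sum => j _.
have := sqr_ge0 (v 0 j - t * w 0 j); nra.
Qed.

(** Right multiplication by it pads each row with [q + 1] zeros, which isolates the part of the
    input that is linear in [Z]. *)
Definition z_embedding (R : realType) (q d' : nat) : 'M[R]_(d', d' + q + 1) :=
  row_mx (row_mx 1%:M 0) 0.

Lemma qSA_inputD (R : realType) (N q d' : nat) (Z Z' : 'M[R]_(N, d')) y :
  qSA_input (Z + Z') y = Z *m z_embedding R q d' + qSA_input Z' y.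
Proof. by rewrite /qSA_input !mul_mx_row mulmx1 !mulmx0 !add_row_mx !add0r. Qed.

Lemma qSAN (R : realType) (N q d' : nat) (Z : 'M[R]_(N, d'))
    (y : 'I_N -> 'I_q -> 'I_N) :
  qSA (- Z) y = - qSA Z y.
Proof.
apply/matrixP => i k; rewrite !mxE !summxE -mulrN -sumrN.
by congr (_ * _); apply: eq_bigr => j _; rewrite !mxE.
Qed.

(** With [E] the matrix of the padding map on flattened matrices, [E *m W^T] has [N * d'] rows but
    rank at most that of [W], so some nonzero row vector is killed from the left. *)
Lemma rank_lt_kernel_z (R : realType) (N q d' m : nat)
    (W : 'M[R]_(m, N * (d' + q + 1))) :
  (\rank W < N * d')%N ->
  exists2 Z : 'M[R]_(N, d'), Z != 0 &
    W *m flatten_mx (Z *m z_embedding R q d') = 0.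
Proof.
move=> rW.
pose E : 'M[R]_(N * d', N * (d' + q + 1)) := lin_mulmxr (z_embedding R q d').
have : kermx (E *m W^T) != 0.
  rewrite kermx_eq0 /row_free neq_ltn (leq_ltn_trans _ rW) //.
  by rewrite -(mxrank_tr W) mxrankM_maxr.
case/rowV0Pn => v /sub_kermxP vE nz.
exists (vec_mx v); first by rewrite vec_mx_eq0.
apply: trmx_inj; rewrite trmx_mul trmxK trmx0 -vE mulmxA.
by rewrite -[in RHS](vec_mxK v) mul_vec_lin.
Qed.

Lemma exists_unit_max_row (R : realType) (N d' : nat) (Z : 'M[R]_(N, d')) :
  Z != 0 ->
  exists2 c : R, forall i, norm2 (row i (c *: Z)) <= 1 &
    exists i, norm2 (row i (c *: Z)) = 1.
Proof.
move=> nzZ.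
have [i0 nzi0] : exists i0, row i0 Z != 0.
  apply/existsP; rewrite -negb_forall; apply: contra nzZ => /forallP Z0.
  by apply/eqP/row_matrixP => i; rewrite row0 (eqP (Z0 i)).
have [i _ imax] := @arg_maxP _ _ _ i0 xpredT (fun i => norm2 (row i Z)) isT.
have gt0 : 0 < norm2 (row i Z).
  apply: lt_le_trans (imax i0 isT).
  by rewrite lt_def norm2_eq0 nzi0 sqrtr_ge0.
exists (norm2 (row i Z))^-1 => [k|].
  rewrite linearZ norm2Z gtr0_norm ?invr_gt0 //.
  by rewrite ler_pdivrMl // mulr1; exact: imax.
by exists i; rewrite linearZ norm2Z gtr0_norm ?invr_gt0 // mulVf ?gt_eqF.
Qed.

Lemma approximates_qSA_row (R : realType) (N q d' : nat) (eps : R)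
    (f : 'cV[R]_(N * (d' + q + 1)) -> 'cV[R]_(N * d'))
    (Z : 'M[R]_(N, d')) (y : 'I_N -> 'I_q -> 'I_N) (i : 'I_N) :
  approximates_qSA eps f -> valid_qSA_input Z y ->
  norm2 (block (f (flatten_mx (qSA_input Z y))) i - row i (qSA Z y)) <= eps.
Proof.
by move=> happ hv; apply: le_trans (happ Z y hv); exact: le_bigmax.
Qed.

Lemma norm2N (R : realType) (n : nat) (v : 'rV[R]_n) : norm2 (- v) = norm2 v.
Proof. by rewrite -scaleN1r norm2Z normrN1 mul1r. Qed.

(** A block [p] of the common output lies within [1 / (2 * q)] of both [row i A] and its negative.
    Pairing with [w] and eliminating [p] bounds the average by [1 / (2 * q)], hence the sum by
    [1 / 2]. *)
Lemma dot_sum_le_half (R : realType) (N q d' m : nat)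
    (W : 'M[R]_(m, N * (d' + q + 1)))
    (g : 'cV[R]_m -> 'cV[R]_(N * d'))
    (f : 'cV[R]_(N * (d' + q + 1)) -> 'cV[R]_(N * d'))
    (hq : (0 < q)%N)
    (hf : forall x, f x = g (W *m x))
    (happrox : approximates_qSA (1 / (2 * q%:R)) f)
    (Z : 'M[R]_(N, d')) (hZ : forall i, norm2 (row i Z) <= 1)
    (hW : W *m flatten_mx (Z *m z_embedding R q d') = 0)
    (w : 'rV[R]_d') (hw : norm2 w = 1)
    (y : 'I_q -> 'I_N) (hy : injective y) :
  `|\sum_(j < q) \sum_(k < d') Z (y j) k * w 0 k| <= 2^-1.
Proof.
have q0 : 0 < q%:R :> R by rewrite ltr0n.
have e0 : 0 < 1 / (2 * q%:R) :> R by rewrite divr_gt0 // mulr_gt0.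
pose y' (i : 'I_N) := y.
have v1 : valid_qSA_input Z y' by split.
have v2 : valid_qSA_input (- Z) y' by split=> // i; rewrite linearN /= norm2N.
have fE : f (flatten_mx (qSA_input (- Z) y')) = f (flatten_mx (qSA_input Z y')).
  have flatD (A B : 'M[R]_(N, d' + q + 1)) :
      flatten_mx (A + B) = flatten_mx A + flatten_mx B.
    by rewrite /flatten_mx !linearD.
  have ZE : Z = Z + (Z + - Z) by rewrite subrr addr0.
  by rewrite !hf [in RHS]ZE !qSA_inputD !flatD !mulmxDr hW !add0r.
(* All rows share the same [y], so any row index serves; this one is at hand because [q > 0]. *)
pose i := y (Ordinal hq).
have := approximates_qSA_row _ _ _ _ _ _ _ _ i happrox v1.
have := approximates_qSA_row _ _ _ _ _ _ _ _ i happrox v2.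
rewrite fE qSAN; set p := block _ _; set A := qSA Z y' => b2 b1.
have b1' : norm2 (row i A - p) <= 1 / (2 * q%:R) by rewrite -norm2N opprB.
have b2' : norm2 (- (p - row i (- A))) <= 1 / (2 * q%:R) by rewrite norm2N.
have AE : q%:R * \sum_(k < d') A i k * w 0 k
          = \sum_(j < q) \sum_(k < d') Z (y j) k * w 0 k.
  rewrite exchange_big mulr_sumr; apply: eq_bigr => k _ /=.
  rewrite !mxE summxE !mulrA mulfV ?gt_eqF // mul1r mulr_suml.
  by apply: eq_bigr => j _; rewrite mxE.
have dots (u v : 'rV[R]_d') :
    \sum_(k < d') (u + v) 0 k * w 0 k
    = \sum_(k < d') u 0 k * w 0 k + \sum_(k < d') v 0 k * w 0 k.
  by rewrite -big_split; apply: eq_bigr => k _; rewrite mxE mulrDl.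
have dotN (u : 'rV[R]_d') :
    \sum_(k < d') (- u) 0 k * w 0 k = - \sum_(k < d') u 0 k * w 0 k.
  by rewrite -sumrN; apply: eq_bigr => k _; rewrite mxE mulNr.
have rA : \sum_(k < d') (row i A) 0 k * w 0 k = \sum_(k < d') A i k * w 0 k.
  by apply: eq_bigr => k _; rewrite mxE.
have := dot_le_norm2 _ _ _ _ _ e0 b1 hw.
have := dot_le_norm2 _ _ _ _ _ e0 b2 hw.
have := dot_le_norm2 _ _ _ _ _ e0 b1' hw.
have := dot_le_norm2 _ _ _ _ _ e0 b2' hw.
rewrite linearN /= !(dotN, dots) rA -AE => h1 h2 h3 h4.
have half : q%:R * (1 / (2 * q%:R)) = 2^-1 :> R by field; rewrite gt_eqF.
rewrite -half ler_norml -mulrN !ler_pM2l //.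
by apply/andP; split; lra.
Qed.

Theorem theorem10 (R : realType) (N q d' m : nat)
  (hN : (1 <= N)%N) (hq : (1 <= q)%N) (hd' : (1 <= d')%N)
  (hqN : q%:R <= N%:R / 2 :> R)
  (W : 'M[R]_(m, N * (d' + q + 1)))
  (g : 'cV[R]_m -> 'cV[R]_(N * d'))
  (f : 'cV[R]_(N * (d' + q + 1)) -> 'cV[R]_(N * d'))
  (hf : forall x, f x = g (W *m x))
  (happrox : approximates_qSA (1 / (2 * q%:R)) f) :
  (\rank W <= m)%N /\ (N * d')%N%:R / 2 <= (\rank W)%:R :> R.
Proof.
split; first exact: rank_leq_row.
suff rW : (N * d' <= \rank W)%N.
  have : (N * d')%:R <= (\rank W)%:R :> R by rewrite ler_nat.
  have : 0 <= (N * d')%:R :> R by [].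
  lra.
rewrite leqNgt; apply/negP => /rank_lt_kernel_z[Z0 nzZ0 WZ0].
have [c hZ [i hi]] := exists_unit_max_row _ _ _ _ nzZ0.
have WZ : W *m flatten_mx ((c *: Z0) *m z_embedding R q d') = 0.
  by rewrite /flatten_mx -scalemxAl !linearZ /= WZ0 scaler0.
have ltqN : (q < N)%N.
  rewrite -(ltr_nat R).
  have : 1 <= q%:R :> R by rewrite ler1n.
  lra.
have half0 : 0 < 2^-1 :> R by rewrite invr_gt0.
(* Taking the unit row itself as [w] makes [a i] its squared norm 1, against the strict bound
   [2 * 2^-1]. *)
pose a l := \sum_(k < d') (c *: Z0) l k * row i (c *: Z0) 0 k.
have := lt_of_injective_sums _ _ _ a _ hq ltqN half0
  (dot_sum_le_half _ _ _ _ _ _ g _ hq hf happrox _ hZ WZ _ hi) i.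
rewrite /a mulfV ?pnatr_eq0 // -[ltRHS](expr1n _ 2) -hi norm2_sqr => /lt_eqF/eqP.
by apply; apply: eq_bigr => k _; rewrite [row _ _ 0 k]mxE expr2.
Qed.
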